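(* The covariance function of the process $X^{ls}(t)$, $t>0$, defined in the context satisfies $$\gamma^{ls}(t,u)\equiv\langle X^{ls}(t),X^{ls}(u)\rangle=\sum_{m=1}^{\infty}\sum_{n=m-1}^{m+1}\gamma^{ls}_{mn}(t,u)\,I_{B_m}(t)I_{B_n}(u),$$ where $$\gamma^{ls}_{mm}(t,u)\equiv\langle X^{ls}_m(t),X^{ls}_m(u)\rangle=\psi_m(t+u)\gamma_m(t-u)+\psi_{m-1}(t+u)\gamma_{m-1}(t-u),$$ and, for $|n-m|=1$, $$\gamma^{ls}_{mn}(t,u)\equiv\langle X^{ls}_m(t),X^{ls}_n(u)\rangle=\psi_k(t+u)\gamma_k(t-u),\qquad k=\min\{m,n\},$$ in which $\psi_m(t+u)=\langle U^m(t),U^m(u)\rangle$ and $\gamma_m(t-u)=\langle Y^s_m(t),Y^s_m(u)\rangle$ for $m\in\mathbb N$ (terms involving $B_0$, $\psi_0$ or $\gamma_0$ are omitted).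
   Context: Notation: $\mathbb N=\{1,2,\dots\}$, $I_B$ is the indicator function of $B$, and $\langle x,y\rangle=\operatorname{cov}(x,y)$. Fix $T\in\mathbb N$. Partition: $0=s_0<s_1<\cdots$, $B_j=(s_{j-1},s_j]$ for $j\in\mathbb N$, with $|B_j|=|B_{j+kT}|$ for $k\in\mathbb N$, where $|\cdot|$ denotes length; $S=\sum_{i=1}^T|B_i|$. $\{Y^s_j(t),\ t\in B_j\cup B_{j+1}\}$, $j\in\mathbb N$, is a sequence of independent stationary processes, $Y^s_j(t)=\int_{-\infty}^\infty e^{it\lambda}\eta_j(d\lambda)$ with $\eta_j$ orthogonally scattered random measures, $\eta_j\stackrel{d}{=}\eta_{j+T}$, and $\{Y^s_j(t)\}\stackrel{d}{=}\{Y^s_{j+kT}(t+kS)\}$ for $k\in\mathbb N$. $\{U^j(t)\}$, $j\in\mathbb N$, is a random weight process with exponentially convex covariance, independent of the processes $Y^s_j(\cdot)$. (Exponentially convex: the covariance function $\langle Z(t_i),\overline{Z(t_j)}\rangle=\psi(t_i+t_j)$ of a second order zero mean process $Z$ with finite variance is called exponentially convex if and only if $\sum_{i=1}^n\sum_{j=1}^n c_i\overline{c_j}\psi(t_i+t_j)\ge0$ for all finite sets of complex $c_1,\dots,c_n$ and real points $t_1,\dots,t_n$.) The process $X^{ls}$ is $$X^{ls}(t)=\sum_{j=1}^\infty X^{ls}_j(t)I_{B_j}(t),$$ where $X^{ls}_1(t)=U^1(t)Y^s_1(t)$ for $t\in B_1$ and $X^{ls}_j(t)=U^{j-1}(t)Y^s_{j-1}(t)+U^j(t)Y^s_j(t)$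 for $t\in B_j$, $j\ge2$.
   Formalization: The orthogonally scattered random measures η_j are taken to have mean zero, so the stationary processes Y^s_j are centred; without this the covariance formula fails (e.g. Y^s_j a random constant with non-zero mean). *)

(* Defs.v *)
From HB Require Import structures.
From mathcomp Require Import all_boot all_order all_algebra.
From mathcomp Require Import all_classical all_reals all_analysis.
From mathcomp Require Import complex.

Set Implicit Arguments.
Unset Strict Implicit.
Unset Printing Implicit Defensive.

Import Order.TTheory GRing.Theory Num.Theory ComplexField.
Import numFieldNormedType.Exports.

Local Open Scope classical_set_scope.
Local Open Scope ring_scope.
Local Open Scope complex_scope.

(* Families indexed by j = 1, 2, ... are functions on nat, used for 0 < j only:
   their values at j = 0 are junk on which nothing is assumed. *)

Section complex_random_variables.
Context d (Omega : measurableType d) (R : realType) (P : probability Omega R).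
Implicit Types X Z : Omega -> R[i].

Definition cexpect Z : R[i] :=
  fine 'E_P[fun w => complex.Re (Z w)]%E +i*
  fine 'E_P[fun w => complex.Im (Z w)]%E.

Definition ccov X Z : R[i] :=
  cexpect (fun w => (X w - cexpect X) * (Z w - cexpect Z)^*).

Definition second_order Z : Prop :=
  ((fun w => complex.Re (Z w)) \in Lfun P 2%:E) /\
  ((fun w => complex.Im (Z w)) \in Lfun P 2%:E).

Definition mean_square Z : \bar R :=
  (\int[P]_w (Normc.normc (Z w) ^+ 2)%:E)%E.

End complex_random_variables.

(* Borel sets of the complex plane, identified with R * R. *)
Definition cmeasurable (R : realType) (M : set R[i]) : Prop :=
  measurable [set p : R * R | M (p.1 +i* p.2)].

Section processes.
Context d (Omega : measurableType d) (R : realType) (P : probability Omega R).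

Definition process_sigma (I : Type) (D : set I) (Z : I -> Omega -> R[i]) :
    set (set Omega) :=
  <<s [set E | exists2 i, D i & exists2 M, cmeasurable M & E = Z i @^-1` M] >>.

Definition independent2 (G H : set (set Omega)) : Prop :=
  forall A B, G A -> H B -> P (A `&` B) = (P A * P B)%E.

Definition mutually_independent (J : set nat) (G : nat -> set (set Omega)) :
    Prop :=
  forall (js : seq nat) (A : nat -> set Omega),
    uniq js -> (forall j, j \in js -> J j /\ G j (A j)) ->
    P (\bigcap_(j in [set` js]) A j) = (\prod_(j <- js) P (A j))%E.

(* Equality in distribution of the processes (Z i), i in D, and (Z' i), i in D:
   same law on the sigma-algebra of the path space generated by the coordinates
   of index in D. *)
Definition path_sigma (I : Type) (D : set I) : set (set (I -> R[i])) :=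
  <<s [set E | exists2 i, D i &
         exists2 M, cmeasurable M & E = [set f | M (f i)]] >>.

Definition eq_law (I : Type) (D : set I) (Z Z' : I -> Omega -> R[i]) : Prop :=
  forall E, path_sigma D E ->
    P [set w | E (fun i => Z i w)] = P [set w | E (fun i => Z' i w)].

(* Second-order (wide-sense) stationarity, with covariance function gamma. *)
Definition stationary (D : set R) (Z : R -> Omega -> R[i]) (gamma : R -> R[i]) :
    Prop :=
  [/\ forall t, D t -> second_order P (Z t),
      exists c, forall t, D t -> cexpect P (Z t) = c &
      forall t u, D t -> D u -> ccov P (Z t) (Z u) = gamma (t - u)].

Definition exp_convex_cov (D : set R) (Z : R -> Omega -> R[i])
    (psi : R -> R[i]) : Prop :=
  [/\ forall t, D t -> second_order P (Z t),
      forall t, D t -> cexpect P (Z t) = 0,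
      forall t u, D t -> D u -> ccov P (Z t) (Z u) = psi (t + u) &
      forall (n : nat) (c : 'I_n -> R[i]) (t : 'I_n -> R), (forall i, D (t i)) ->
        0 <= \sum_i \sum_j c i * (c j)^* * psi (t i + t j)].

(* Orthogonally scattered random measures on the Borel sets of the line:
   countably additive with values in the space of centered square integrable
   random variables, orthogonal on disjoint sets. *)
Definition orth_scattered (eta : set R -> Omega -> R[i]) : Prop :=
  [/\ forall A, measurable A ->
        second_order P (eta A) /\ cexpect P (eta A) = 0,
      forall A : (set R)^nat, (forall k, measurable (A k)) -> trivIset setT A ->
        (fun n => mean_square P (fun w =>
           \sum_(k < n) eta (A k) w - eta (\bigcup_k A k) w)) @ \oo --> 0%E &
      forall A B, measurable A -> measurable B -> A `&` B = set0 ->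
        ccov P (eta A) (eta B) = 0].

(* A simple function sum_k c_k 1_{A_k} is the list of the pairs (c_k, A_k). *)
Definition simple_val (g : seq (R[i] * set R)) (x : R) : R[i] :=
  \sum_(p <- g) p.1 * \1_(p.2) x.

Definition simple_int (eta : set R -> Omega -> R[i]) (g : seq (R[i] * set R))
    (w : Omega) : R[i] :=
  \sum_(p <- g) p.1 * eta p.2 w.

(* Z = \int f d(eta): if F(A) = E|eta A|^2 is the control measure of eta, the
   integral is the isometric extension from the simple functions of L^2(F) to
   L^2(F); as an element of L^2(P), it is defined up to almost sure equality. *)
Definition stoch_integral (eta : set R -> Omega -> R[i]) (f : R -> R[i])
    (Z : Omega -> R[i]) : Prop :=
  exists F : {measure set (measurableTypeR R) -> \bar R},
    (forall A, measurable A -> F A = mean_square P (eta A)) /\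
    exists g : nat -> seq (R[i] * set R),
      [/\ forall n p, p \in g n -> measurable p.2,
          (fun n => \int[F]_x
             (Normc.normc (simple_val (g n) x - f x) ^+ 2)%:E)%E @ \oo --> 0%E &
          (fun n => mean_square P (fun w => simple_int eta (g n) w - Z w))
             @ \oo --> 0%E].

End processes.

(* lambda |-> e^{i t lambda} *)
Definition expi (R : realType) (t lambda : R) : R[i] :=
  cos (t * lambda) +i* sin (t * lambda).

Section partition.
Context (R : realType).
Implicit Types (T j k : nat) (s : nat -> R).

Definition block s j : set R := `]s j.-1, s j].

Definition block_len s j : R := s j - s j.-1.

Definition period_len T s : R := \sum_(1 <= i < T.+1) block_len s i.

(* B_j `|` B_{j+1}, the index set of Y_j. *)
Definition dom2 s j : set R := block s j `|` block s j.+1.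

Definition periodic_partition T s : Prop :=
  [/\ s 0%N = 0, forall j, s j < s j.+1 &
      forall j k, (0 < j)%N -> (0 < k)%N ->
        block_len s j = block_len s (j + k * T)%N].

End partition.

Section the_process.
Context (Omega : Type) (R : realType).
Implicit Types (s : nat -> R) (U Y : nat -> R -> Omega -> R[i]).

Definition X_piece U Y (j : nat) (t : R) (w : Omega) : R[i] :=
  (if (1 < j)%N then U j.-1 t w * Y j.-1 t w else 0) + U j t w * Y j t w.

(* The complex plane R[i] carries its topology as the normed space R[i]^o. *)
Definition X_ls s U Y (t : R) (w : Omega) : R[i] :=
  limn (fun N =>
    \sum_(1 <= j < N) X_piece U Y j t w * \1_(block s j) t : R[i]^o).

End the_process.

(* Main.v *)
(** Write [X_m = V_{m-1} + V_m] on [B_m], with [V_j = U^j Y_j]. Each [Y_j] is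
    centered, being a mean-square limit of linear combinations of the centered
    variables [eta_j A]. As the processes [U] are independent of the [Y], the
    expectation [E(V_i(t) V_k(u)^* )] factors as
    [E(U^i(t) U^k(u)^* ) E(Y_i(t) Y_k(u)^* )]; for [i = k] this is
    [psi_i(t+u) gamma_i(t-u)], and for [i <> k] the second factor vanishes,
    since [Y_i] and [Y_k] are independent and centered. In [cov(X_m(t), X_n(u))]
    only the indices shared by [{m-1, m}] and [{n-1, n}] survive. *)
Require Import Defs.
From HB Require Import structures.
From mathcomp Require Import all_boot all_order all_algebra.
From mathcomp Require Import all_classical all_reals all_analysis.
From mathcomp Require Import complex.
From mathcomp Require Import measurable_realfun zify ring.

Set Implicit Arguments.
Unset Strict Implicit.
Unset Printing Implicit Defensive.

Import Order.TTheory GRing.Theory Num.Theory ComplexField.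
Import numFieldNormedType.Exports.

Local Open Scope classical_set_scope.
Local Open Scope ring_scope.
Local Open Scope complex_scope.

(** * Expectation of a product of independent real variables *)

Section independence.
Context d (Omega : measurableType d) (R : realType) (P : probability Omega R).
Implicit Types f g : Omega -> R.

(* The joint law of (f, g) is the product of the marginal laws, so that Fubini
   applies. *)
Lemma expectationM_indep f g :
  (forall A B, measurable A -> measurable B ->
    P (f @^-1` A `&` g @^-1` B) = (P (f @^-1` A) * P (g @^-1` B))%E) ->
  f \in Lfun P 1 -> g \in Lfun P 1 ->
  f \* g \in Lfun P 1 /\ ('E_P[f \* g] = 'E_P[f] * 'E_P[g])%E.
Proof.
move=> fg /Lfun1_integrable if_ /Lfun1_integrable ig.
have mf : measurable_fun setT f.
  by apply/measurable_EFinP; exact: measurable_int if_.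
have mg : measurable_fun setT g.
  by apply/measurable_EFinP; exact: measurable_int ig.
pose F : {mfun Omega >-> R} :=
  HB.pack f (isMeasurableFun.Build _ _ _ _ f mf).
pose G : {mfun Omega >-> R} :=
  HB.pack g (isMeasurableFun.Build _ _ _ _ g mg).
pose h w : R * R := (f w, g w).
have mh : measurable_fun setT h by exact: measurable_fun_pair.
pose H : {mfun Omega >-> (R * R)%type} :=
  HB.pack h (isMeasurableFun.Build _ _ _ _ h mh).
pose PF := distribution P F; pose PG := distribution P G.
pose PH := distribution P H.
have PHE A : measurable A -> (PF \x PG)%E A = PH A.
  apply: product_measure_unique => A1 A2 mA1 mA2.
  exact: fg.
pose pr (z : R * R) : \bar R := (z.1 * z.2)%:E.
have mpr : measurable_fun setT pr.
  apply/measurable_EFinP; apply: measurable_funM;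
    [exact: measurable_fst|exact: measurable_snd].
have iF : PF.-integrable setT (EFin : R -> \bar R).
  exact: integrable_pushforward.
have iG : PG.-integrable setT (EFin : R -> \bar R).
  exact: integrable_pushforward.
(* By Tonelli, the iterated integral of [|x y|] factors into the two first absolute moments, both
   finite. *)
have ipr : (PF \x PG)%E.-integrable setT pr.
  apply/integrable12ltyP => //.
  rewrite (_ : (\int[PF]_x _)%E =
      (\int[PF]_x (`|x%:E| * \int[PG]_y `|y%:E|))%E); last first.
    apply: eq_integral => x _.
    rewrite -ge0_integralZl//.
      by apply: eq_integral => y _; rewrite -abseM.
    exact/measurableT_comp.
  have [_ iGlt] := integrableP _ _ _ iG.
  have [_ iFlt] := integrableP _ _ _ iF.
  rewrite ge0_integralZr//; [|exact: measurableT_comp|exact: integral_ge0].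
  by apply: lte_mul_pinfty => //; [exact: integral_ge0|
    rewrite ge0_fin_numE//; exact: integral_ge0].
have PHint (k : R * R -> \bar R) :
    (\int[PH]_z k z = \int[(PF \x PG)%E]_z k z)%E.
  by apply: eq_measure_integral => A mA _; exact/esym/PHE.
have ifg : P.-integrable setT (EFin \o (f \* g)).
  have [_ prlt] := integrableP _ _ _ ipr.
  apply/integrableP; split.
    by apply/measurable_EFinP; exact: measurable_funM.
  move: prlt; rewrite -PHint ge0_integral_pushforward//.
  exact: measurableT_comp.
split; first exact/Lfun1_integrable.
rewrite !unlock.
have -> : (\int[P]_w ((f \* g) w)%:E = \int[PH]_z pr z)%E.
  by rewrite integral_pushforward.
rewrite PHint -integral12_prod_meas1// /fubini_F.
have -> : (\int[P]_w (f w)%:E = \int[PF]_x x%:E)%E.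
  by rewrite integral_pushforward.
have -> : (\int[P]_w (g w)%:E = \int[PG]_x x%:E)%E.
  by rewrite integral_pushforward.
(* Written as the image of a real number, the mean of [g] is a constant that may enter the integral
   over [x]. *)
have /fineK <- := integrable_fin_num measurableT iG.
rewrite -integralZr//; apply: eq_integral => x _.
have /fineK -> := integrable_fin_num measurableT iG.
by rewrite -integralZl.
Qed.

End independence.

(** * Real and imaginary parts of complex-valued functions *)

Section complex_functions.
Context (T : Type) (R : realType).
Implicit Types Z W : T -> R[i].

Lemma Re_funD Z W : (fun w => complex.Re (Z w + W w)) =
  (fun w => complex.Re (Z w)) \+ (fun w => complex.Re (W w)).
Proof. by apply/funext => w; rewrite raddfD. Qed.

Lemma Im_funD Z W : (fun w => complex.Im (Z w + W w)) =
  (fun w => complex.Im (Z w)) \+ (fun w => complex.Im (W w)).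
Proof. by apply/funext => w; rewrite raddfD. Qed.

Lemma Re_funM Z W : (fun w => complex.Re (Z w * W w)) =
  ((fun w => complex.Re (Z w)) \* (fun w => complex.Re (W w))) \-
  ((fun w => complex.Im (Z w)) \* (fun w => complex.Im (W w))).
Proof. by apply/funext => w /=; case: (Z w) => a b; case: (W w). Qed.

Lemma Im_funM Z W : (fun w => complex.Im (Z w * W w)) =
  ((fun w => complex.Re (Z w)) \* (fun w => complex.Im (W w))) \+
  ((fun w => complex.Im (Z w)) \* (fun w => complex.Re (W w))).
Proof. by apply/funext => w /=; case: (Z w) => a b; case: (W w). Qed.

Lemma Re_funJ Z : (fun w => complex.Re (Z w)^*) = (fun w => complex.Re (Z w)).
Proof. by apply/funext => w; case: (Z w). Qed.

Lemma Im_funJ Z : (fun w => complex.Im (Z w)^*) = - (fun w => complex.Im (Z w)).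
Proof. by apply/funext => w; rewrite !fctE/=; case: (Z w). Qed.

End complex_functions.

(** * Measurability of complex-valued functions *)

Section complex_measurable_functions.
Context d (T : measurableType d) (R : realType).
Implicit Types Z W : T -> R[i].

Definition complex_measurable Z : Prop :=
  measurable_fun setT (fun w => complex.Re (Z w)) /\
  measurable_fun setT (fun w => complex.Im (Z w)).

Lemma complex_measurableM Z W : complex_measurable Z -> complex_measurable W ->
  complex_measurable (fun w => Z w * W w).
Proof.
move=> [Z1 Z2] [W1 W2]; split; rewrite ?Re_funM ?Im_funM.
- by apply: measurable_funB; apply: measurable_funM.
- by apply: measurable_funD; apply: measurable_funM.
Qed.

Lemma complex_measurable_conj Z :
  complex_measurable Z -> complex_measurable (fun w => (Z w)^*).
Proof.
by move=> [Z1 Z2]; split; rewrite ?Re_funJ ?Im_funJ//; exact: measurable_funN.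
Qed.

End complex_measurable_functions.

(** * Integrability and expectation of complex random variables *)

Section complex_random_variables.
Context d (Omega : measurableType d) (R : realType) (P : probability Omega R).
Implicit Types (Z W : Omega -> R[i]).

Definition complex_L1 Z : Prop :=
  (fun w => complex.Re (Z w)) \in Lfun P 1 /\
  (fun w => complex.Im (Z w)) \in Lfun P 1.

Let finP : P setT \is a fin_num := fin_num_measure P _ measurableT.

Lemma second_order_L1 Z : second_order P Z -> complex_L1 Z.
Proof. by case=> Z1 Z2; split; exact: Lfun_subset12. Qed.

Lemma complex_L1D Z W :
  complex_L1 Z -> complex_L1 W -> complex_L1 (fun w => Z w + W w).
Proof.
by move=> [Z1 Z2] [W1 W2]; split; rewrite ?Re_funD ?Im_funD; exact: rpredD.
Qed.

Lemma cexpectD Z W : complex_L1 Z -> complex_L1 W ->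
  cexpect P (fun w => Z w + W w) = cexpect P Z + cexpect P W.
Proof.
move=> [Z1 Z2] [W1 W2]; rewrite /cexpect Re_funD Im_funD.
by rewrite !expectationD// !fineD// ?expectation_fin_num.
Qed.

Lemma complex_L1_conj Z : complex_L1 Z -> complex_L1 (fun w => (Z w)^*).
Proof. by move=> [Z1 Z2]; split; rewrite ?Re_funJ ?Im_funJ ?rpredN. Qed.

Lemma cexpect_cst (c : R[i]) : cexpect P (fun=> c) = c.
Proof. by rewrite /cexpect !expectation_cst; case: c. Qed.

Lemma complex_L1M Z W : second_order P Z -> second_order P W ->
  complex_L1 (fun w => Z w * W w).
Proof.
move=> [Z1 Z2] [W1 W2]; split; rewrite ?Re_funM ?Im_funM.
- by apply: rpredB; exact: Lfun2_mul_Lfun1.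
- by apply: rpredD; exact: Lfun2_mul_Lfun1.
Qed.

(* Discharges the side condition of [rpredN] and [rpredD] on [Lfun P 2%:E]. *)
Let le12 : (1 <= 2%:E :> \bar R)%E. Proof. by rewrite lee1n. Qed.

Lemma second_order_conj Z :
  second_order P Z -> second_order P (fun w => (Z w)^*).
Proof.
by move=> [Z1 Z2]; split; rewrite ?Re_funJ ?Im_funJ// (@rpredN _ (Lfun P 2%:E)).
Qed.

Lemma second_order0 : second_order P (fun=> 0).
Proof. by split; exact: Lfun_cst. Qed.

Lemma second_orderD Z W :
  second_order P Z -> second_order P W -> second_order P (fun w => Z w + W w).
Proof.
by move=> [Z1 Z2] [W1 W2]; split; rewrite ?Re_funD ?Im_funD; exact: rpredD.
Qed.

Lemma second_orderZ (c : R[i]) Z :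
  second_order P Z -> second_order P (fun w => c * Z w).
Proof.
move=> [Z1 Z2]; have r2 : 1 <= 2 :> R by rewrite ler1n.
split.
- rewrite (_ : (fun w => _) =
    complex.Re c \o* (fun w => complex.Re (Z w)) -
    complex.Im c \o* (fun w => complex.Im (Z w))).
    by apply: (@rpredB _ (Lfun P 2%:E)); exact: Lfun_scale.
  by apply/funext => w; rewrite !fctE/=; case: (Z w) => a b;
    case: c => e f /=; ring.
- rewrite (_ : (fun w => _) =
    complex.Re c \o* (fun w => complex.Im (Z w)) +
    complex.Im c \o* (fun w => complex.Re (Z w))).
    by apply: rpredD; exact: Lfun_scale.
  by apply/funext => w; rewrite !fctE/=; case: (Z w) => a b;
    case: c => e f /=; ring.
Qed.

Lemma cexpectZ (c : R[i]) Z : complex_L1 Z ->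
  cexpect P (fun w => c * Z w) = c * cexpect P Z.
Proof.
move=> [Z1 Z2]; rewrite /cexpect.
rewrite (_ : (fun w => complex.Re (c * Z w)) =
    (complex.Re c \o* (fun w => complex.Re (Z w))) \-
    (complex.Im c \o* (fun w => complex.Im (Z w)))); last first.
  by apply/funext => w /=; case: (Z w) => a b; case: c => e f /=; ring.
rewrite (_ : (fun w => complex.Im (c * Z w)) =
    (complex.Re c \o* (fun w => complex.Im (Z w))) \+
    (complex.Im c \o* (fun w => complex.Re (Z w)))); last first.
  by apply/funext => w /=; case: (Z w) => a b; case: c => e f /=; ring.
rewrite expectationB ?expectationD ?Lfun_scale//.
rewrite !expectationZl// fineB ?fineD ?fin_numM ?expectation_fin_num//.
rewrite !fineM ?expectation_fin_num//.
by case: c => e f.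
Qed.

(** The ascriptions to [g_sigma_algebraType] make [Z] and [W] measurable for the generated
    sigma-algebras, so preimages of Borel sets under their real and imaginary parts are events to
    which independence applies. The real case then handles each of the four real products in
    [Z w * W w]. *)
Lemma cexpectM_indep (G H : set (set Omega)) Z W :
  independent2 P <<s G >> <<s H >> ->
  complex_measurable (Z : g_sigma_algebraType G -> R[i]) ->
  complex_measurable (W : g_sigma_algebraType H -> R[i]) ->
  complex_L1 Z -> complex_L1 W ->
  complex_L1 (fun w => Z w * W w) /\
  cexpect P (fun w => Z w * W w) = cexpect P Z * cexpect P W.
Proof.
move=> GH [mZ1 mZ2] [mW1 mW2] [Z1 Z2] [W1 W2].
have ind (f g : Omega -> R) :
    measurable_fun setT (f : g_sigma_algebraType G -> R) ->
    measurable_fun setT (g : g_sigma_algebraType H -> R) ->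
    f \in Lfun P 1 -> g \in Lfun P 1 ->
    f \* g \in Lfun P 1 /\ ('E_P[f \* g] = 'E_P[f] * 'E_P[g])%E.
  move=> mf mg; apply: expectationM_indep => A B mA mB; apply: GH.
    by rewrite -[X in <<s G >> X]setTI; exact: mf.
  by rewrite -[X in <<s H >> X]setTI; exact: mg.
have [i11 e11] := ind _ _ mZ1 mW1 Z1 W1.
have [i12 e12] := ind _ _ mZ1 mW2 Z1 W2.
have [i21 e21] := ind _ _ mZ2 mW1 Z2 W1.
have [i22 e22] := ind _ _ mZ2 mW2 Z2 W2.
split.
  by split; [rewrite Re_funM; exact: rpredB|rewrite Im_funM; exact: rpredD].
rewrite /cexpect Re_funM Im_funM expectationB// expectationD// e11 e12 e21 e22.
by rewrite fineB ?fineD ?fin_numM ?expectation_fin_num//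
  !fineM ?expectation_fin_num.
Qed.

Let Lfun_measurable (f : Omega -> R) p :
  f \in Lfun P p -> measurable_fun setT f.
Proof. by move/sub_Lfun_mfun; rewrite inE. Qed.

(** A variance is nonnegative: for [f] the real or imaginary part of [Z], the square of E(f) is at
    most E(f^2), which is at most E|Z|^2. *)
Lemma sqr_cexpect_le_mean_square Z : second_order P Z ->
  ((complex.Re (cexpect P Z) ^+ 2)%:E <= mean_square P Z)%E /\
  ((complex.Im (cexpect P Z) ^+ 2)%:E <= mean_square P Z)%E.
Proof.
move=> [Z1 Z2].
have normc2 w : Normc.normc (Z w) ^+ 2 =
    complex.Re (Z w) ^+ 2 + complex.Im (Z w) ^+ 2.
  by case: (Z w) => a b /=; rewrite sqr_sqrtr// addr_ge0// sqr_ge0.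
have mRe : measurable_fun setT (fun w => complex.Re (Z w)).
  exact: Lfun_measurable Z1.
have mIm : measurable_fun setT (fun w => complex.Im (Z w)).
  exact: Lfun_measurable Z2.
have sqr_le (f : Omega -> R) : f \in Lfun P 2%:E ->
    (forall w, f w ^+ 2 <= Normc.normc (Z w) ^+ 2) ->
    ((fine 'E_P[f] ^+ 2)%:E <= mean_square P Z)%E.
  move=> f2 fZ; have f1 := Lfun_subset12 finP f2.
  have := variance_ge0 P f.
  rewrite varianceE// sube_ge0; last first.
    by rewrite fin_numX// expectation_fin_num.
  rewrite EFin_expe fineK ?expectation_fin_num// => /le_trans; apply.
  rewrite unlock (_ : f ^+ 2 = fun w => f w ^+ 2); last first.
    by apply/funext => w; rewrite !fctE.
  apply: ge0_le_integral => //.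
  - by move=> w _; rewrite lee_fin sqr_ge0.
  - apply/measurable_EFinP; apply: measurable_funX.
    exact: Lfun_measurable f2.
  - apply/measurable_EFinP; under eq_fun do rewrite normc2.
    by apply: measurable_funD; apply: measurable_funX.
  - by move=> w _; rewrite lee_fin fZ.
split; apply: sqr_le => // w; rewrite normc2.
- by rewrite lerDl sqr_ge0.
- by rewrite lerDr sqr_ge0.
Qed.

(** Since [S n - Z] has expectation [- cexpect P Z] for every [n], the previous bound puts two
    constants, the squared real and imaginary parts of [cexpect P Z], below a sequence tending to
    0. *)
Lemma cvg_mean_square_cexpect0 (S : nat -> Omega -> R[i]) Z :
  (forall n, second_order P (S n) /\ cexpect P (S n) = 0) -> second_order P Z ->
  (fun n => mean_square P (fun w => S n w - Z w)) @ \oo --> 0%E ->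
  cexpect P Z = 0.
Proof.
pose D n w := S n w - Z w.
move=> hS Z2 SZ0.
have NE : (fun w => - Z w) = (fun w => -1 * Z w).
  by apply/funext => w; rewrite mulN1r.
have NZ2 : second_order P (fun w => - Z w).
  by rewrite NE; exact: second_orderZ.
have SZ n := sqr_cexpect_le_mean_square (second_orderD (hS n).1 NZ2).
have {}SZ n :
    ((complex.Re (cexpect P Z) ^+ 2)%:E <= mean_square P (D n))%E /\
    ((complex.Im (cexpect P Z) ^+ 2)%:E <= mean_square P (D n))%E.
  move: (SZ n); rewrite cexpectD;
    [|exact: second_order_L1 (hS n).1|exact: second_order_L1].
  rewrite (hS n).2 add0r NE cexpectZ; last exact: second_order_L1.
  by case: (cexpect P Z) => a b; rewrite mulN1r /= !sqrrN.
have sqr0 (x : R) : (forall n, ((x ^+ 2)%:E <= mean_square P (D n))%E) -> x = 0.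
  move=> xS; apply/eqP; rewrite -sqrf_eq0 eq_le sqr_ge0 andbT -lee_fin.
  have : ((x ^+ 2)%:E <= limn (fun n => mean_square P (D n)))%E.
    apply: lime_ge; last exact: nearW.
    by apply/cvg_ex; exists 0%E.
  by rewrite (cvg_lim _ SZ0).
apply/eqP; rewrite eq_complex; apply/andP; split; apply/eqP; apply: sqr0 => n.
- exact: (SZ n).1.
- exact: (SZ n).2.
Qed.

End complex_random_variables.

(** * Coordinate sigma-algebras, covariances and stochastic integrals *)

Section processes.
Context d (Omega : measurableType d) (R : realType) (P : probability Omega R).

(** The generating family of [process_sigma], named so that [g_sigma_algebraType] can be applied to
    it. *)
Definition coordinate_events (I : Type) (D : set I) (Z : I -> Omega -> R[i]) :
    set (set Omega) :=
  [set E | exists2 i, D i & exists2 M, cmeasurable M & E = Z i @^-1` M].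

(** Preimages of a Borel set under the real and imaginary parts are preimages under [Z i] of a strip
    in the plane, which is Borel because the projections are measurable. *)
Lemma complex_measurable_coordinate (I : Type) (D : set I)
    (Z : I -> Omega -> R[i]) i :
  D i ->
  complex_measurable (Z i : g_sigma_algebraType (coordinate_events D Z) -> R[i]).
Proof.
move=> Di; split=> _ B mB; rewrite setTI; apply: sub_gen_smallest;
  exists i => //.
- exists [set z | B (complex.Re z)] => //.
  rewrite /cmeasurable -[X in measurable X]setTI.
  have mf : measurable_fun [set: R * R] fst by exact: measurable_fst.
  exact: (mf measurableT B mB).
- exists [set z | B (complex.Im z)] => //.
  rewrite /cmeasurable -[X in measurable X]setTI.
  have mf : measurable_fun [set: R * R] snd by exact: measurable_snd.
  exact: (mf measurableT B mB).
Qed.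

Lemma ccov_centered (Z W : Omega -> R[i]) :
  cexpect P Z = 0 -> cexpect P W = 0 ->
  ccov P Z W = cexpect P (fun w => Z w * (W w)^*).
Proof.
by move=> Z0 W0; rewrite /ccov Z0 W0; congr cexpect;
  apply/funext => w; rewrite !subr0.
Qed.

Lemma ccov0l (Z : Omega -> R[i]) : ccov P (fun=> 0) Z = 0.
Proof.
rewrite /ccov cexpect_cst (_ : (fun w => _) = fun=> 0) ?cexpect_cst//.
by apply/funext => w; rewrite subr0 mul0r.
Qed.

Lemma ccov0r (Z : Omega -> R[i]) : ccov P Z (fun=> 0) = 0.
Proof.
rewrite /ccov cexpect_cst (_ : (fun w => _) = fun=> 0) ?cexpect_cst//.
by apply/funext => w; rewrite subr0 rmorph0 mulr0.
Qed.

(** [Z] is a mean-square limit of integrals of simple functions. Each of these is a finite linear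
    combination of centered variables [eta A], hence centered, by induction on the list of pairs. *)
Lemma cexpect_stoch_integral (eta : set R -> Omega -> R[i]) f Z :
  orth_scattered P eta -> stoch_integral P eta f Z -> second_order P Z ->
  cexpect P Z = 0.
Proof.
move=> [eta0 _ _] [F [_ [g [mg _ gZ]]]] Z2.
apply: cvg_mean_square_cexpect0 gZ => // n; move: (mg n).
elim: (g n) => [_|p l IH mpl].
  rewrite (_ : simple_int eta [::] = fun=> 0); last first.
    by apply/funext => w; rewrite /simple_int big_nil.
  by split; [exact: second_order0|exact: cexpect_cst].
have [IH2 IH0] :
    second_order P (simple_int eta l) /\ cexpect P (simple_int eta l) = 0.
  by apply: IH => q ql; apply: mpl; rewrite inE ql orbT.
have [p2 p0] : second_order P (eta p.2) /\ cexpect P (eta p.2) = 0.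
  by apply: eta0; apply: mpl; rewrite mem_head.
rewrite (_ : simple_int eta (p :: l) =
    fun w => p.1 * eta p.2 w + simple_int eta l w); last first.
  by apply/funext => w; rewrite /simple_int big_cons.
have pp2 := second_orderZ p.1 p2.
split; first exact: second_orderD.
rewrite cexpectD; [|exact: second_order_L1..].
by rewrite cexpectZ ?IH0 ?p0 ?mulr0 ?addr0//; exact: second_order_L1.
Qed.

End processes.

(** * Disjointness of the blocks and values of [X_ls] *)

(** If [m < n], monotonicity gives [s m <= s n.-1], which contradicts [t <= s m] and [s n.-1 < t];
    the other case is symmetric. *)
Lemma block_inj (R : realType) (s : nat -> R) m n t :
  (forall j, s j < s j.+1) -> (0 < m)%N -> (0 < n)%N ->
  block s m t -> block s n t -> m = n.
Proof.
move=> hs m0 n0.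
have {}hs : {homo s : i j / (i <= j)%N >-> i <= j}.
  by apply: homo_leq => // [i j k|i]; [exact: le_trans|exact: ltW].
rewrite /block/= !in_itv/= => /andP[mt tm] /andP[nt tn].
have [mn|nm|//] := ltngtP m n.
- have sle : s m <= s n.-1 by apply: hs; rewrite -ltnS prednK.
  by have := lt_le_trans nt (le_trans tm sle); rewrite ltxx.
- have sle : s n <= s m.-1 by apply: hs; rewrite -ltnS prednK.
  by have := lt_le_trans mt (le_trans tn sle); rewrite ltxx.
Qed.

Lemma block_dom2 (R : realType) (s : nat -> R) j t : block s j t -> dom2 s j t.
Proof. by left. Qed.

Lemma block_dom2_pred (R : realType) (s : nat -> R) j t :
  (0 < j)%N -> block s j t -> dom2 s j.-1 t.
Proof. by case: j => // j _; right. Qed.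

(** Once [N] exceeds [m], the partial sum reduces to its term of index [m], so the sequence is
    eventually constant. *)
Lemma X_ls_block (Omega : Type) (R : realType) (s : nat -> R)
    (U Y : nat -> R -> Omega -> R[i]) m t :
  (forall j, s j < s j.+1) -> (0 < m)%N -> block s m t ->
  X_ls s U Y t = X_piece U Y m t.
Proof.
move=> hs m0 mt; apply/funext => w; rewrite /X_ls.
apply/(@cvg_lim R[i]^o) => //; apply: cvg_near_cst; exists m.+1 => // N /= mN.
rewrite (bigD1_seq m) ?iota_uniq ?mem_index_iota ?m0//= big1_seq ?addr0.
  by rewrite indicE mem_set// mulr1.
move=> j /andP[jm]; rewrite mem_index_iota => /andP[j0 _].
rewrite indicE memNset ?mulr0// => jt.
by move/eqP: jm; apply; exact: block_inj jt mt.
Qed.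

Lemma X_ls_outside (Omega : Type) (R : realType) (s : nat -> R)
    (U Y : nat -> R -> Omega -> R[i]) t :
  (forall m, (0 < m)%N -> ~ block s m t) -> X_ls s U Y t = fun=> 0.
Proof.
move=> nt; apply/funext => w; rewrite /X_ls.
apply/(@cvg_lim R[i]^o) => //; apply: cvg_near_cst; apply: nearW => N.
apply: big1_seq => j /andP[_]; rewrite mem_index_iota => /andP[j0 _].
by rewrite indicE memNset ?mulr0//; exact: nt.
Qed.

(** * The covariance of the process *)

Theorem lemma3p1
  (R : realType) (d : measure_display) (Omega : measurableType d)
  (P : probability Omega R)
  (T : nat) (s : nat -> R)
  (eta : nat -> set R -> Omega -> R[i])
  (Y U : nat -> R -> Omega -> R[i])
  (DU : nat -> set R)
  (psi gamma : nat -> R -> R[i])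
  (hT : (0 < T)%N)
  (hs : periodic_partition T s)
  (hYstat : forall j, (0 < j)%N -> stationary P (dom2 s j) (Y j) (gamma j))
  (hYindep : mutually_independent P [set j | (0 < j)%N]
     (fun j => process_sigma (dom2 s j) (Y j)))
  (heta : forall j, (0 < j)%N -> orth_scattered P (eta j))
  (hYeta : forall j t, (0 < j)%N -> dom2 s j t ->
     stoch_integral P (eta j) (expi t) (Y j t))
  (hetaT : forall j, (0 < j)%N ->
     eq_law P measurable (eta j) (eta (j + T)%N))
  (hYT : forall j k, (0 < j)%N -> (0 < k)%N ->
     eq_law P (dom2 s j) (Y j)
       (fun t => Y (j + k * T)%N (t + k%:R * period_len T s)))
  (hDU : forall j, (0 < j)%N -> dom2 s j `<=` DU j)
  (hU : forall j, (0 < j)%N -> exp_convex_cov P (DU j) (U j) (psi j))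
  (hUY : independent2 P
     (process_sigma [set jt : nat * R | (0 < jt.1)%N /\ DU jt.1 jt.2]
        (fun jt => U jt.1 jt.2))
     (process_sigma [set jt : nat * R | (0 < jt.1)%N /\ dom2 s jt.1 jt.2]
        (fun jt => Y jt.1 jt.2))) :
  [/\ forall t u : R, 0 < t -> 0 < u ->
        (fun N => \sum_(1 <= m < N) \sum_(m.-1 <= n < m.+2 | (0 < n)%N)
           ccov P (X_piece U Y m t) (X_piece U Y n u)
             * \1_(block s m) t * \1_(block s n) u : R[i]^o) @ \oo
        --> (ccov P (X_ls s U Y t) (X_ls s U Y u) : R[i]^o),
      forall (m : nat) (t u : R), (0 < m)%N -> block s m t -> block s m u ->
        ccov P (X_piece U Y m t) (X_piece U Y m u) =
          psi m (t + u) * gamma m (t - u)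
          + (if (1 < m)%N then psi m.-1 (t + u) * gamma m.-1 (t - u) else 0) &
      forall (m n : nat) (t u : R), (0 < m)%N -> (0 < n)%N ->
        (n = m.+1 \/ m = n.+1) -> block s m t -> block s n u ->
        ccov P (X_piece U Y m t) (X_piece U Y n u) =
          psi (minn m n) (t + u) * gamma (minn m n) (t - u)].
Proof.
have [_ sS _] := hs.
have Y2 j t : (0 < j)%N -> dom2 s j t -> second_order P (Y j t).
  by move=> j0 jt; have [+ _ _] := hYstat j j0; exact.
have Y0 j t : (0 < j)%N -> dom2 s j t -> cexpect P (Y j t) = 0.
  move=> j0 jt.
  exact: cexpect_stoch_integral (heta j j0) (hYeta j t j0 jt) (Y2 j t j0 jt).
have U2 j t : (0 < j)%N -> dom2 s j t -> second_order P (U j t).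
  by move=> j0 jt; have [+ _ _ _] := hU j j0; apply; exact: hDU.
have U0 j t : (0 < j)%N -> dom2 s j t -> cexpect P (U j t) = 0.
  by move=> j0 jt; have [_ + _ _] := hU j j0; apply; exact: hDU.
have UU i j t u : (0 < i)%N -> (0 < j)%N -> dom2 s i t -> dom2 s j u ->
    complex_L1 P (fun w => U i t w * (U j u w)^*).
  move=> i0 j0 it ju; apply: complex_L1M; first exact: U2.
  by apply: second_order_conj; exact: U2.
have YY i j t u : (0 < i)%N -> (0 < j)%N -> dom2 s i t -> dom2 s j u ->
    complex_L1 P (fun w => Y i t w * (Y j u w)^*).
  move=> i0 j0 it ju; apply: complex_L1M; first exact: Y2.
  by apply: second_order_conj; exact: Y2.
have YY0 i j t u :
    (0 < i)%N -> (0 < j)%N -> dom2 s i t -> dom2 s j u -> i != j ->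
    cexpect P (fun w => Y i t w * (Y j u w)^*) = 0.
  move=> i0 j0 it ju ij.
  have ind : independent2 P (process_sigma (dom2 s i) (Y i))
      (process_sigma (dom2 s j) (Y j)).
    move=> A B hA hB.
    (* Mutual independence is specialized to a list of two distinct indices. *)
    have := hYindep [:: i; j] (fun k => if k == i then A else B).
    rewrite /= inE ij => /(_ isT).
    rewrite bigcap_seq !big_cons !big_nil eqxx (eq_sym j) (negbTE ij).
    rewrite mule1 setIT.
    apply=> k; rewrite !inE => /orP[] /eqP ->; first by rewrite eqxx.
    by rewrite eq_sym (negbTE ij).
  have mYi := complex_measurable_coordinate (Y i) it.
  have mYj := complex_measurable_conj (complex_measurable_coordinate (Y j) ju).
  have Yj := second_order_L1 (Y2 j u j0 ju).
  have [_ ->] := cexpectM_indep ind mYi mYj (second_order_L1 (Y2 i t i0 it))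
    (complex_L1_conj Yj).
  by rewrite Y0// mul0r.
(* Setting [V 0] to zero encodes the omitted terms of index 0, so that [X_piece] at [j] is
   [V j.-1 + V j] even for [j = 1]. [C i k] is the value to be found for E(V_i V_k^* ). *)
pose V i t w := if (0 < i)%N then U i t w * Y i t w else 0.
pose C i k t u :=
  if (i == k) && (0 < i)%N then psi i (t + u) * gamma i (t - u) else 0.
(* Measurability is taken for the sigma-algebra of the whole family, indexed by pairs [(j, v)],
   because [hUY] concerns all the [U] and all the [Y] jointly. *)
have mU j v (j0 : (0 < j)%N) (jv : dom2 s j v) :=
  complex_measurable_coordinate (fun jt => U jt.1 jt.2)
  (conj j0 (hDU j j0 v jv) :
    [set jt : nat * R | (0 < jt.1)%N /\ DU jt.1 jt.2] (j, v)).
have mY j v (j0 : (0 < j)%N) (jv : dom2 s j v) :=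
  complex_measurable_coordinate (fun jt => Y jt.1 jt.2)
  (conj j0 jv : [set jt : nat * R | (0 < jt.1)%N /\ dom2 s jt.1 jt.2] (j, v)).
have VL1 i t : ((0 < i)%N -> dom2 s i t) ->
    complex_L1 P (V i t) /\ cexpect P (V i t) = 0.
  rewrite /V; case: ltnP => [i0 /(_ isT) it|_ _]; last first.
    by split; [exact: second_order_L1 (second_order0 P)|exact: cexpect_cst].
  have [L ->] := cexpectM_indep hUY (mU i t i0 it) (mY i t i0 it)
    (second_order_L1 (U2 i t i0 it))
    (second_order_L1 (Y2 i t i0 it)).
  by split=> //; rewrite U0// mul0r.
have VV i k t u : ((0 < i)%N -> dom2 s i t) -> ((0 < k)%N -> dom2 s k u) ->
    complex_L1 P (fun w => V i t w * (V k u w)^*) /\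
    cexpect P (fun w => V i t w * (V k u w)^*) = C i k t u.
  rewrite /V /C; case: (ltnP 0 i) => [i0 /(_ isT) it|_ _ _]; last first.
    rewrite andbF (_ : (fun w => _) = fun=> 0); last first.
      by apply/funext => w; rewrite mul0r.
    by split; [exact: second_order_L1 (second_order0 P)|exact: cexpect_cst].
  case: (ltnP 0 k) => [k0 /(_ isT) ku|k0 _]; last first.
    (* Here [k] is 0 and [i] is positive, so [C i k] vanishes along with [V k]. *)
    have /negbTE -> : i != k by rewrite gtn_eqF// (leq_ltn_trans k0).
    rewrite (_ : (fun w => _) = fun=> 0); last first.
      by apply/funext => w; rewrite rmorph0 mulr0.
    by split; [exact: second_order_L1 (second_order0 P)|exact: cexpect_cst].
  have mUU := complex_measurableM (mU i t i0 it)
    (complex_measurable_conj (mU k u k0 ku)).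
  have mYY := complex_measurableM (mY i t i0 it)
    (complex_measurable_conj (mY k u k0 ku)).
  have [L E] := cexpectM_indep hUY mUU mYY
    (UU i k t u i0 k0 it ku) (YY i k t u i0 k0 it ku).
  (* The factors are regrouped so that the [U] part and the [Y] part separate. *)
  rewrite (_ : (fun w => _) =
      fun w => (U i t w * (U k u w)^*) * (Y i t w * (Y k u w)^*)); last first.
    by apply/funext => w; rewrite rmorphM/= mulrACA.
  split; [exact: L|rewrite E andbT].
  (* For [i = k] both factors are covariances, since [U i] and [Y i] are centered. *)
  have [ik|ik] := eqVneq i k; last by rewrite YY0// mulr0.
  subst k; have [_ _ psiE _] := hU i i0; have [_ _ gammaE] := hYstat i i0.
  rewrite -gammaE// -psiE; [|exact: (hDU i i0)..].
  by rewrite !ccov_centered ?U0 ?Y0.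
have XV j t : (0 < j)%N -> X_piece U Y j t = fun w => V j.-1 t w + V j t w.
  move=> j0; apply/funext => w; rewrite /X_piece /V j0.
  by case: j j0 => [|[|j]].
have dom j t : (0 < j)%N -> block s j t ->
    ((0 < j.-1)%N -> dom2 s j.-1 t) /\ ((0 < j)%N -> dom2 s j t).
  by move=> j0 jt; split=> _; [exact: block_dom2_pred|exact: block_dom2].
(* Both pieces are centered, so the covariance expands into the four expectations computed in
   [VV]. *)
have XX m n t u : (0 < m)%N -> (0 < n)%N -> block s m t -> block s n u ->
    ccov P (X_piece U Y m t) (X_piece U Y n u) =
    C m.-1 n.-1 t u + C m.-1 n t u + (C m n.-1 t u + C m n t u).
  move=> m0 n0 mt nu; rewrite !XV//.
  have [d1 d2] := dom _ _ m0 mt; have [d3 d4] := dom _ _ n0 nu.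
  have [L1 E1] := VL1 _ _ d1; have [L2 E2] := VL1 _ _ d2.
  have [L3 E3] := VL1 _ _ d3; have [L4 E4] := VL1 _ _ d4.
  rewrite ccov_centered ?cexpectD ?E1 ?E2 ?E3 ?E4 ?addr0//.
  have [L13 <-] := VV _ _ _ _ d1 d3; have [L14 <-] := VV _ _ _ _ d1 d4.
  have [L23 <-] := VV _ _ _ _ d2 d3; have [L24 <-] := VV _ _ _ _ d2 d4.
  rewrite -(cexpectD L13 L14) -(cexpectD L23 L24) -cexpectD;
    [|exact: complex_L1D..].
  by congr cexpect; apply/funext => w; rewrite rmorphD/= mulrDl !mulrDr.
have indic0 m t : ~ block s m t -> \1_(block s m) t = 0 :> R[i].
  by move=> mt; rewrite indicE memNset.
split.
- move=> t u _ _.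
  (* When [t] or [u] lies in no block, the process is 0 there and every term of the double sum
     vanishes. *)
  have [[m [m0 mt]]|nt] :=
    pselect (exists m, (0 < m)%N /\ block s m t); last first.
    have {}nt k : (0 < k)%N -> ~ block s k t.
      by move=> k0 kt; apply: nt; exists k.
    rewrite (X_ls_outside _ _ nt) ccov0l.
    apply: cvg_near_cst; apply: nearW => N.
    apply: big1_seq => k /andP[_]; rewrite mem_index_iota => /andP[k0 _].
    by apply: big1 => l _; rewrite (indic0 k) ?mulr0 ?mul0r//; exact: nt.
  have [[n [n0 nu]]|nu] :=
    pselect (exists n, (0 < n)%N /\ block s n u); last first.
    have {}nu k : (0 < k)%N -> ~ block s k u.
      by move=> k0 ku; apply: nu; exists k.
    rewrite (X_ls_outside _ _ nu) ccov0r.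
    apply: cvg_near_cst; apply: nearW => N.
    apply: big1 => k _; apply: big1 => l l0.
    by rewrite (indic0 l) ?mulr0//; exact: nu.
  rewrite (X_ls_block _ _ sS m0 mt) (X_ls_block _ _ sS n0 nu).
  (* For [N > m] only the row of index [m] survives, and in it only the column of index [n],
     provided that [n] is in the summation range [m.-1 <= n < m.+2]. *)
  apply: cvg_near_cst; exists m.+1 => // N /= mN.
  rewrite (bigD1_seq m) ?iota_uniq ?mem_index_iota ?m0//=.
  rewrite [X in _ + X]big1_seq ?addr0; last first.
    move=> k /andP[km]; rewrite mem_index_iota => /andP[k0 _].
    apply: big1 => l _; rewrite (indic0 k) ?mulr0 ?mul0r// => kt.
    by move/eqP: km; apply; exact: block_inj kt mt.
  have other k : (0 < k)%N -> k != n -> \1_(block s k) u = 0 :> R[i].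
    move=> k0 /eqP kn; apply: indic0 => ku; apply: kn.
    exact: block_inj ku nu.
  rewrite big_mkcond/=; have [nI|nI] := boolP (n \in index_iota m.-1 m.+2).
    rewrite (bigD1_seq n) ?iota_uniq//= n0 big1 ?addr0.
      by rewrite !indicE !mem_set// !mulr1.
    by move=> k kn; case: ltnP => // k0; rewrite other// mulr0.
  (* If [n] is outside that range, the sum is 0; so is the covariance, because [m.-1] and [m] both
     differ from [n.-1] and [n]. *)
  rewrite XX// big1_seq; last first.
    move=> k /andP[_ kI]; case: ltnP => // k0; rewrite other ?mulr0//.
    by apply: contraNneq nI => <-.
  move: nI; rewrite mem_index_iota /C => nI.
  have /negbTE -> : m.-1 != n.-1 by lia.
  have /negbTE -> : m.-1 != n by lia.
  have /negbTE -> : m != n.-1 by lia.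
  have /negbTE -> : m != n by lia.
  by rewrite !addr0.
(* With equal blocks the two diagonal terms remain; the guard [0 < m.-1] of [C] drops the term of
   index 0 when [m = 1]. *)
- move=> m t u m0 mt mu; rewrite XX// /C !eqxx m0.
  have /negbTE -> : m.-1 != m by lia.
  have /negbTE -> : m != m.-1 by lia.
  have -> : (0 < m.-1)%N = (1 < m)%N by lia.
  by rewrite /= addr0 add0r addrC.
- move=> m n t u m0 n0 mn mt nu; rewrite XX// /C.
  have /negbTE -> : m.-1 != n.-1 by lia.
  (* Adjacent blocks share one index: [m = n.-1] in the first case, [m.-1 = n] in the second. It is
     the minimum of [m] and [n]. *)
  case: mn => mn; subst.
  + have /negbTE -> : m.-1 != m.+1 by lia.
    have /negbTE -> : m != m.+1 by lia.
    have -> : minn m m.+1 = m by lia.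
    by rewrite /= eqxx m0 !addr0 !add0r.
  + have /negbTE -> : n.+1 != n.-1 by lia.
    have /negbTE -> : n.+1 != n by lia.
    have -> : minn n.+1 n = n by lia.
    by rewrite /= eqxx n0 !addr0 !add0r.
Qed.
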